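(* Let $n\ge 3$, $2\le \Delta\le n-1$, and $\alpha_1\le \alpha<0$, where $\alpha_1\approx -1.7036$ is the unique root of $\frac{3^\alpha-4^\alpha}{4^\alpha-5^\alpha}=2$. For every tree $G$ with $n$ vertices and maximum degree $\Delta$, \[\chi_\alpha(G)\le \begin{cases} \big((\Delta+2)^\alpha-(\Delta+1)^\alpha+3^\alpha\big)(n-\Delta-1)+\Delta(\Delta+1)^\alpha & \text{if } \frac{n}{2}\le \Delta\le n-1,\\ \big((\Delta+2)^\alpha+3^\alpha-4^\alpha\big)\Delta+(n-\Delta-1)4^\alpha & \text{if } 2\le \Delta\le \frac{n-1}{2}.\end{cases}\] For $\frac{n}{2}\le\Delta\le n-1$ equality holds if and only if $G=T_{n,\Delta}$; for $2\le\Delta\le\frac{n-1}{2}$ equality holds if and only if $G$ is a tree obtained from a single vertex by attaching $\Delta$ paths, each having at least two vertices, to that vertex.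
   Context: All graphs are finite and simple; $d(v)$ denotes the degree of $v$. The general sum-connectivity index is $\chi_\alpha(G)=\sum_{uv\in E(G)}(d(u)+d(v))^\alpha$. Attaching a path $P_r$ (path on $r$ vertices) to a vertex $v$ means adding a disjoint copy of $P_r$ and an edge between $v$ and a terminal vertex of the path. For $\frac n2\le\Delta\le n-1$, $T_{n,\Delta}$ is the tree obtained from a single vertex $v$ by attaching $2\Delta+1-n$ pendant vertices and $n-\Delta-1$ copies of $P_2$ (paths of length two from $v$) to $v$; it has $n$ vertices and maximum degree $\Delta$. *)

(* Defs.v *)
From Stdlib Require Import Reals.
From mathcomp Require Import all_boot.
Set Implicit Arguments. Unset Strict Implicit. Unset Printing Implicit Defensive.

Definition simple_graph (n : nat) (e : rel 'I_n) : Prop :=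
  symmetric e /\ irreflexive e.

Definition deg (n : nat) (e : rel 'I_n) (v : 'I_n) : nat := #|[pred u | e v u]|.

Definition max_deg (n : nat) (e : rel 'I_n) : nat := \max_(v : 'I_n) deg e v.

Definition acyclic (n : nat) (e : rel 'I_n) : Prop :=
  ~ exists c : seq 'I_n, [&& cycle e c, uniq c & 2 < size c].

Definition connected (n : nat) (e : rel 'I_n) : Prop :=
  forall u v : 'I_n, connect e u v.

Definition is_tree (n : nat) (e : rel 'I_n) : Prop :=
  simple_graph e /\ connected e /\ acyclic e.

Definition chi (n : nat) (e : rel 'I_n) (alpha : R) : R :=
  foldr Rplus R0
    [seq Rpower (INR (deg e uv.1 + deg e uv.2)) alpha
     | uv : 'I_n * 'I_n <- [seq uv : 'I_n * 'I_n <- enum {: 'I_n * 'I_n} | (uv.1 < uv.2)%N && e uv.1 uv.2]].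

Definition isomorphic (n : nat) (e1 e2 : rel 'I_n) : Prop :=
  exists f : 'I_n -> 'I_n, bijective f /\ forall x y, e1 x y = e2 (f x) (f y).

(* Spider: vertex 0 with paths of ls_1, ls_2, ... vertices attached; the j-th
   path occupies vertices starting at 1 + (ls_1 + ... + ls_{j-1}) consecutively.
   (Meaningful when sumn ls = n - 1 and all entries are >= 1.) *)
Definition spider_starts (ls : seq nat) : seq nat :=
  [seq (sumn (take j ls)).+1 | j <- iota 0 (size ls)].

Definition spider_adj (n : nat) (ls : seq nat) (x y : 'I_n) : bool :=
  ((val x == 0) && (val y \in spider_starts ls))
  || ((0 < val x) && (val y == (val x).+1) && (val y \notin spider_starts ls)).

Definition spider (n : nat) (ls : seq nat) : rel 'I_n :=
  fun x y => spider_adj ls x y || spider_adj ls y x.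

Definition T_tree (n Delta : nat) : rel 'I_n :=
  @spider n (nseq (2 * Delta + 1 - n) 1 ++ nseq (n - Delta - 1) 2).

Definition long_spider (n Delta : nat) (e : rel 'I_n) : Prop :=
  exists ls : seq nat,
    [/\ size ls = Delta, all (fun l => 2 <= l) ls, sumn ls = (n - 1)%N
      & isomorphic e (@spider n ls)].

(* Main.v *)
(** Root the tree at a vertex [r] of degree [Delta], so that every edge joins a
    vertex [u <> r] to its parent [p u]. For every [lam] and [psi],
    [chi] is [(n - 1) lam + Delta psi(Delta)] plus the sum over [u <> r] of
    [(d(u) + d(p u))^alpha - lam + (d(u) - 1) psi(d(u)) - psi(d(p u))],
    because [w <> r] is the parent of [d(w) - 1] vertices and [r] of [Delta].
    Take for [psi b] the best value, at cost [lam] per edge, of a branch hanging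
    from a vertex of degree [b]. Then every summand is nonpositive, with equality
    exactly for pendant paths of the right lengths, so that equality forces a
    spider. The only delicate sign, at vertices [u <> r] of degree [a >= 3], is
    [(a - 2) (3^alpha - 4^alpha) <= (a - 1) (4^alpha - (a + 2)^alpha)]. *)

Require Import Defs.
From Stdlib Require Import Reals Lra.
From HB Require Import structures.
From mathcomp Require Import all_boot zify.
Set Implicit Arguments.
Unset Strict Implicit.
Unset Printing Implicit Defensive.

(** * Rooted trees *)

(** A simple path from [x] to [y] avoiding this edge, closed up by it, would be a cycle. *)
Lemma tree_edge_bridge n (e : rel 'I_n) x y :
  is_tree e -> e x y ->
  ~~ connect [rel a b | e a b && ([set a; b] != [set x; y])] x y.
Proof.
move=> [[esym eirr] [_ acyc]] exy; apply/negP => /connectP[t].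
case/shortenP => s path_s uniq_s _ lastE; apply: acyc; exists (x :: s).
have sub : subrel [rel a b | e a b && ([set a; b] != [set x; y])] e by move=> a b /andP[].
rewrite uniq_s /= rcons_path (sub_path sub path_s) -lastE esym exy /=.
(* The cycle has at least three vertices: an empty [s] would make the edge a loop, and a single
   vertex in [s] would use the removed edge. *)
case: s path_s lastE {uniq_s} => [_ yx|z [|//]] /=; first by rewrite yx eirr in exy.
by rewrite andbT => /andP[_ neq] yz; rewrite yz eqxx in neq.
Qed.

(** The depth makes [p] well founded, so that induction on it replaces induction on trees. *)
Record rooting n (e : rel 'I_n) (r : 'I_n) (p : 'I_n -> 'I_n) (d : 'I_n -> nat) :
    Prop := Rooting {
  parent_root : p r = r;
  depth_root : d r = 0;
  depthE : forall u, u != r -> d u = (d (p u)).+1;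
  edgeE : forall x y, e x y = (x != r) && (p x == y) || (y != r) && (p y == x) }.

(** The parent is a neighbour one step nearer to [r]. If an edge [xy] joined no vertex to its
    parent, both ends would reach [r] along parent edges, all different from [xy], against
    [tree_edge_bridge]. *)
Lemma tree_rooting n (e : rel 'I_n) r :
  is_tree e -> exists p d, rooting e r p d.
Proof.
move=> tree; have [[esym eirr] [conn _]] := tree.
pose reach u k := [exists t : k.-tuple 'I_n, path e u t && (last u t == r)].
have reachP u t : path e u t -> last u t = r -> reach u (size t).
  by move=> pt lt; apply/existsP; exists (in_tuple t); rewrite pt lt eqxx.
have reach_ex u : exists k, reach u k.
  by have /connectP[t pt lt] := conn u r; exists (size t); apply: reachP.
pose d u := ex_minn (reach_ex u).
have d_le u k : reach u k -> d u <= k by rewrite /d; case: ex_minnP => m _; apply.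
have d_reach u : reach u (d u) by rewrite /d; case: ex_minnP.
have step u : u != r -> exists w, e u w && (d u == (d w).+1).
  move=> ur; case/existsP: (d_reach u) => -[[|w t] /= sz].
    by rewrite (negbTE ur).
  move=> /andP[/andP[euw pt] /eqP lt]; exists w; rewrite euw /= eqn_leq.
  have -> : (d w).+1 <= d u by rewrite -(eqP sz) ltnS d_le //; apply: reachP.
  case/existsP: (d_reach w) => t' /andP[pt' /eqP lt'].
  have := @reachP u (w :: t'); rewrite /= euw size_tuple => /(_ pt' lt').
  by move/d_le => ->.
(* By [step], the default of [odflt] is never taken when [u != r]. *)
pose p u := if u == r then r else odflt r [pick w | e u w && (d u == (d w).+1)].
have pP u : u != r -> e u (p u) /\ d u = (d (p u)).+1.
  move=> ur; rewrite /p (negbTE ur); case: pickP => [w /andP[? /eqP]|no] //=.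
  by have [w] := step u ur; rewrite no.
exists p, d; split; first by rewrite /p eqxx.
- by apply/eqP; rewrite -leqn0 d_le //; apply: (reachP r [::]).
- by move=> u /pP[].
move=> x y; apply/idP/idP; last first.
  by case/orP=> /andP[/pP[euw _] /eqP <-] //; rewrite esym.
move=> exy; apply: contraT => nparent.
have /negP[] := tree_edge_bridge tree exy.
set e' := [rel a b | _]; have e'sym : symmetric e'.
  by move=> a b; rewrite /= esym setUC.
suff to_r u : connect e' u r.
  by apply: connect_trans (to_r x) _; rewrite (sym_connect_sym e'sym).
have [k] := ubnP (d u); elim: k u => // k IH u; rewrite ltnS => dk.
have [->|ur] := eqVneq u r; first exact: connect0.
have [eup dup] := pP u ur; apply: connect_trans (IH (p u) _); last by rewrite -dup.
apply: connect1; rewrite /= eup /=; apply: contra nparent => /eqP E.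
have : u \in [set x; y] by rewrite -E set21.
have : p u \in [set x; y] by rewrite -E set22.
have pu : p u != u by apply/eqP => pu; move: dup; rewrite pu; lia.
rewrite !inE => /orP[]/eqP E1 /orP[]/eqP E2; move: pu; rewrite E1 E2 ?eqxx //.
  by move=> _; rewrite -E2 ur E1 eqxx orbT.
by move=> _; rewrite -E2 ur E1 eqxx.
Qed.

Section Rooting.

Variables (n : nat) (e : rel 'I_n) (r : 'I_n) (p : 'I_n -> 'I_n) (d : 'I_n -> nat).
Hypothesis rt : rooting e r p d.

Let children w := [pred u | (u != r) && (p u == w)].

Lemma parent_neq u : u != r -> p u != u.
Proof. by move=> ur; apply/eqP => pu; have := depthE rt ur; rewrite pu; lia. Qed.

Lemma edge_parent u : u != r -> e u (p u).
Proof. by move=> ur; rewrite (edgeE rt) ur eqxx. Qed.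

Lemma edge_sym : symmetric e.
Proof. by move=> x y; rewrite !(edgeE rt) orbC. Qed.

(** Every neighbour of [w] except its parent is a child; depths forbid the parent to be a child
    too. *)
Lemma card_children w : #|children w| = deg e w - (w != r).
Proof.
rewrite /deg; have [->|wr] /= := eqVneq w r.
  by rewrite subn0; apply: eq_card => u; rewrite !inE (edgeE rt) eqxx.
rewrite [in RHS](cardD1 (p w)) !inE edge_parent //= addKn; apply: eq_card => u.
rewrite !inE (edgeE rt) wr /=; have [->|upw] := eqVneq u (p w) => //=.
apply/negbTE; apply/andP => -[pwr /eqP ppw].
by have := depthE rt wr; have := depthE rt pwr; rewrite ppw; lia.
Qed.

Lemma deg_gt0 u : u != r -> 0 < deg e u.
Proof. by move=> ur; apply/card_gt0P; exists (p u); rewrite inE edge_parent. Qed.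

Lemma deg_parent_gt1 u : u != r -> p u != r -> 1 < deg e (p u).
Proof.
move=> ur pur; have := card_children (p u); rewrite pur.
suff : 0 < #|children (p u)| by lia.
by apply/card_gt0P; exists u; rewrite inE ur eqxx.
Qed.

Lemma depth_eq0 u : d u = 0 -> u = r.
Proof. by move=> du; apply/eqP; apply: contraT => /(depthE rt); rewrite du. Qed.

End Rooting.

(** * Trees with a single branching vertex are spiders *)

Section Spider.

Variables (n : nat) (e : rel 'I_n) (r : 'I_n) (p : 'I_n -> 'I_n) (d : 'I_n -> nat).
Hypothesis rt : rooting e r p d.

(** For [u != r], the child of [r] whose branch contains [u]: [d u - 1] steps upwards stop just
    below the root. *)
Definition top u := iter (d u).-1 p u.

Definition leg c := #|[pred u | (u != r) && (top u == c)]|.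

Lemma top_child u : u != r -> p u = r -> top u = u.
Proof. by move=> ur pu; rewrite /top (depthE rt ur) pu (depth_root rt). Qed.

Lemma top_parent u : u != r -> p u != r -> top (p u) = top u.
Proof. by move=> ur pur; rewrite /top (depthE rt ur) (depthE rt pur) /= -iterSr. Qed.

Lemma rooted_ind (P : 'I_n -> Prop) :
  (forall u, u != r -> p u = r -> P u) ->
  (forall u, u != r -> p u != r -> P (p u) -> P u) ->
  forall u, u != r -> P u.
Proof.
move=> Pchild Pstep u; have [k] := ubnP (d u); elim: k u => // k IH u; rewrite ltnS => dk ur.
have [pur|pur] := eqVneq (p u) r; first exact: Pchild.
by apply: Pstep => //; apply: IH => //; move: dk; rewrite (depthE rt ur).
Qed.

Lemma topP u : u != r -> top u != r /\ p (top u) = r.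
Proof.
move: u; apply: rooted_ind => u ur pur; first by rewrite top_child.
by rewrite (top_parent ur pur).
Qed.

Lemma leg_gt0 c : c != r -> p c = r -> 0 < leg c.
Proof. by move=> cr pc; apply/card_gt0P; exists c; rewrite inE cr top_child /=. Qed.

(** Such a [c] has a child, and both lie in the leg of [c]. *)
Lemma leg_gt1 c : c != r -> p c = r -> deg e c = 2 -> 1 < leg c.
Proof.
move=> cr pc degc; have := card_children rt c; rewrite degc cr => /eqP.
rewrite subn1 /= eqn_leq => /andP[_ /card_gt0P[u]]; rewrite inE => /andP[ur /eqP pu].
have uc : u != c by apply: contraNneq cr => uc; rewrite -pu uc pc.
rewrite /leg (cardD1 c) (cardD1 u) !inE cr ur uc top_child // -top_parent ?pu //.
by rewrite top_child // !eqxx.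
Qed.

Hypothesis narrow : forall u, u != r -> deg e u <= 2.

Lemma narrow_parent_inj u v :
  u != r -> v != r -> p u != r -> p u = p v -> u = v.
Proof.
move=> ur vr pur puv; have : #|[pred w | (w != r) && (p w == p u)]| <= 1.
  by rewrite (card_children rt) pur leq_subLR narrow.
by move/card_le1_eqP; apply; rewrite inE ?ur ?vr ?puv eqxx.
Qed.

(** No vertex other than [r] has two children, so a leg is a path and the depth locates a vertex on
    it. *)
Lemma top_depth_inj u v :
  u != r -> v != r -> top u = top v -> d u = d v -> u = v.
Proof.
move=> ur; move: u ur v; apply: rooted_ind => u ur pur; [|move=> IH] => v vr.
  rewrite (top_child ur pur) (depthE rt ur) (depthE rt vr) pur (depth_root rt).
  move=> -> [] /esym/(depth_eq0 rt) pv; exact: top_child.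
have [pvr|pvr] := eqVneq (p v) r.
  rewrite (depthE rt ur) (depthE rt vr) pvr (depth_root rt) => _ [] /(depth_eq0 rt) pu.
  by rewrite pu eqxx in pur.
rewrite -(top_parent ur pur) -(top_parent vr pvr) (depthE rt ur) (depthE rt vr) => Et [] Ed.
by apply: narrow_parent_inj => //; apply: IH.
Qed.

Lemma leg_le2 c : (forall u, u != r -> d u <= 2) -> leg c <= 2.
Proof.
(* On a leg the depth is 1 or 2, so the test [d u == 1] embeds the leg into [bool]. *)
move=> shallow; rewrite -card_bool /leg.
rewrite -(@card_in_image _ _ (fun u => d u == 1)) ?max_card // => u v.
rewrite !inE => /andP[ur /eqP tu] /andP[vr /eqP tv] duv.
apply: top_depth_inj => //; first by rewrite tu.
move: duv (shallow u ur) (shallow v vr); rewrite (depthE rt ur) (depthE rt vr) !eqSS.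
by case: (d (p u)) (d (p v)) => [|[|?]] [|[|?]].
Qed.

(** * Numbering the vertices leg by leg *)

Section Positions.

Variable cs : seq 'I_n.
Hypotheses (cs_uniq : uniq cs) (csE : cs =i [pred u | (u != r) && (p u == r)]).

Let ls := map leg cs.
Let idx u := index (top u) cs.
(** Exceeds every depth, so that [idx u * N + d u] determines both the leg and the depth. *)
Let N := (\max_u d u).+1.

(* The lexicographic order on (index of the leg, depth), which lists the vertices
   of the spider; [pos u] is the rank of [u] in it. *)
Let key u := if u == r then 0 else idx u * N + d u.
Let pos u := #|[pred v | key v < key u]|.

Let top_cs u : u != r -> top u \in cs.
Proof. by move=> /topP[tr ptr]; rewrite csE inE tr ptr eqxx. Qed.

Let key_gt0 u : u != r -> 0 < key u.
Proof. by move=> ur; rewrite /key (negbTE ur) (depthE rt ur) addnS. Qed.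

Let d_lt u : d u < N.
Proof. by rewrite ltnS (leq_bigmax u). Qed.

Let key_inj : injective key.
Proof.
move=> u v; have [->|ur] := eqVneq u r; have [->|vr] := eqVneq v r => //.
- by rewrite {1}/key eqxx => E; have := key_gt0 vr; rewrite -E.
- by rewrite [in RHS]/key eqxx => E; have := key_gt0 ur; rewrite E.
rewrite /key (negbTE ur) (negbTE vr) => E.
have Ed : d u = d v.
  by have := congr1 (modn^~ N) E; rewrite /= !modnMDl !modn_small.
apply: top_depth_inj => //; move: E; rewrite Ed => /addIn /eqP.
rewrite eqn_pmul2r // => /eqP E.
by rewrite -(nth_index r (top_cs ur)) -(nth_index r (top_cs vr)) -/(idx u) E.
Qed.

Let pos_mono u v : key u < key v -> pos u < pos v.
Proof.
move=> lt; apply: proper_card; apply/properP; split.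
  by apply/subsetP => w; rewrite !inE => /ltn_trans; apply.
by exists u; rewrite !inE ?ltnn.
Qed.

Let pos_inj : injective pos.
Proof.
move=> u v E; apply: key_inj.
by case: (ltngtP (key u) (key v)) => // /pos_mono; rewrite E ltnn.
Qed.

Let pos_lt u : pos u < n.
Proof.
rewrite -[X in _ < X]card_ord; apply: proper_card; apply/properP; split; first exact/subsetP.
by exists u; rewrite !inE ?ltnn.
Qed.

Let pos_root : pos r = 0.
Proof. by apply: eq_card0 => v; rewrite !inE {2}/key eqxx ltn0. Qed.

Let pos_gt0 u : u != r -> 0 < pos u.
Proof. by move=> ur; apply/card_gt0P; exists r; rewrite inE {1}/key eqxx key_gt0. Qed.

(** The keys of [p u] and [u] are consecutive, so [p u] is the only vertex counted for [u] but not
    for [p u]. *)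
Let pos_parent u : u != r -> p u != r -> pos u = (pos (p u)).+1.
Proof.
move=> ur pur; have keyS : key u = (key (p u)).+1.
  by rewrite /key (negbTE ur) (negbTE pur) /idx top_parent // -addnS (depthE rt ur).
rewrite /pos (cardD1 (p u)) inE keyS ltnSn add1n; congr _.+1.
apply: eq_card => v; rewrite !inE ltnS leq_eqVlt (inj_eq key_inj).
by have [->|] := eqVneq v (p u); rewrite ?ltnn.
Qed.

(** Induction on [j], adding one leg at a time. The root is counted apart, which gives the successor
    also present in [spider_starts]. *)
Let card_first_legs j : j <= size cs ->
  #|[pred v | (v == r) || (idx v < j)]| = (sumn (take j ls)).+1.
Proof.
elim: j => [_|j IH lt].
  rewrite take0 /= -(card1 r); by apply: eq_card => v; rewrite !inE.
rewrite (take_nth 0) ?size_map // sumn_rcons -addSn -IH ?(ltnW lt) //.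
rewrite (nth_map r) // -(cardID [pred v | (v != r) && (idx v == j)]) addnC; congr (_ + _).
  apply: eq_card => v; rewrite !inE; case: eqVneq => //= _.
  by rewrite ltnS; case: ltngtP.
apply: eq_card => v; rewrite !inE; case: eqVneq => //= vr.
rewrite andbC; have -> : (top v == nth r cs j) = (idx v == j).
  rewrite -{1}(nth_index r (top_cs vr)) nth_uniq //.
  by rewrite index_mem top_cs.
by case: eqP => // ->; rewrite ltnSn.
Qed.

(** The key of this child is [j * N + 1], and depths off the root lie between 1 and [N - 1], so the
    smaller keys are those of the root and of the first [j] legs. *)
Let pos_child j : j < size cs -> pos (nth r cs j) = (sumn (take j ls)).+1.
Proof.
move=> lt; rewrite -(card_first_legs (ltnW lt)).
have: nth r cs j \in cs by apply: mem_nth.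
rewrite csE inE => /andP[cr /eqP pc].
have kc : key (nth r cs j) = (j * N).+1.
  rewrite /key (negbTE cr) /idx top_child // index_uniq //.
  by rewrite (depthE rt cr) pc (depth_root rt) addn1.
apply: eq_card => v; rewrite !inE kc; have [->|vr] := eqVneq v r.
  by rewrite /key eqxx.
rewrite /key (negbTE vr) (depthE rt vr) addnS ltnS /=.
have := d_lt v; rewrite (depthE rt vr) => dlt.
by apply/idP/idP; nia.
Qed.

Lemma sumn_legs : sumn (map leg cs) = n - 1.
Proof.
have := card_first_legs (leqnn _); rewrite take_oversize ?size_map // => E.
suff : #|[pred v | (v == r) || (idx v < size cs)]| = n.
  by rewrite E => En; rewrite -[X in X - 1]En subn1.
rewrite -[RHS]card_ord; apply: eq_card => v; rewrite !inE; case: eqVneq => //= vr.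
by rewrite index_mem top_cs.
Qed.

Let pos_start u : (pos u \in spider_starts ls) = (u \in cs).
Proof.
apply/mapP/idP => [[j]|uc].
  rewrite mem_iota size_map /= add0n => lt; rewrite -pos_child // => /pos_inj ->.
  exact: mem_nth.
exists (index u cs); first by rewrite mem_iota size_map /= add0n index_mem.
by rewrite -pos_child ?nth_index // index_mem.
Qed.

(** The rank is the isomorphism: it sends children of [r] to starting positions and any other
    non-root vertex to the position after its parent, as in the two clauses of [spider_adj]. *)
Lemma rooting_spider : isomorphic e (@spider n (map leg cs)).
Proof.
exists (fun u => Ordinal (pos_lt u)); split.
  by apply: injF_bij => u v [] /pos_inj.
suff adjE x y : spider_adj ls (Ordinal (pos_lt x)) (Ordinal (pos_lt y))
                = (y != r) && (p y == x).
  by move=> x y; rewrite /spider !adjE (edgeE rt) orbC.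
rewrite /spider_adj /= !pos_start csE inE.
have pos_eq0 u : (pos u == 0) = (u == r).
  have [->|ur] := eqVneq u r; first by rewrite pos_root.
  by have := pos_gt0 ur; case: (pos u).
rewrite lt0n !pos_eq0; have [->|yr] /= := eqVneq y r.
  by rewrite pos_root /= !andbF.
have [->|xr] /= := eqVneq x r; first by case: (p y == r).
have [pyr|pyr] /= := eqVneq (p y) r.
  by rewrite andbF pyr; apply/esym/negbTE; rewrite eq_sym.
by rewrite andbT pos_parent // eqSS (inj_eq pos_inj).
Qed.

End Positions.
End Spider.

(** * Degrees in the model spider *)

Lemma spider_starts_cons l ls :
  spider_starts (l :: ls) = 1 :: [seq l + x | x <- spider_starts ls].
Proof.
rewrite /spider_starts /= -[1]addn0 iotaDl -!map_comp; congr (_ :: _).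
by apply: eq_map => j /=; rewrite addnS.
Qed.

Lemma spider_starts_gt0 ls x : x \in spider_starts ls -> 0 < x.
Proof. by case/mapP=> j _ ->. Qed.

(** The number after a start is the second vertex of the same leg; it will serve as a second
    neighbour of the start. *)
Lemma long_leg_second ls x :
  all (leq 2) ls -> x \in spider_starts ls ->
  x.+1 \notin spider_starts ls /\ x < sumn ls.
Proof.
elim: ls x => [//|l ls IH] x /= /andP[l2 /IH{}IH].
rewrite spider_starts_cons !inE negb_or => /orP[/eqP->|/mapP[y /IH[ny lty] ->]].
  split; last lia.
  by apply/mapP => -[y /spider_starts_gt0]; lia.
split; last lia.
rewrite -addnS (mem_map (@addnI l)) ny andbT.
by move: lty; lia.
Qed.

(** A vertex that does not start its leg of at most two vertices ends it; not being the last vertex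
    of all, it is followed by a start. *)
Lemma short_leg_end ls x :
  all (fun l => l <= 2) ls -> 0 < x -> x < sumn ls ->
  (x \in spider_starts ls) || (x.+1 \in spider_starts ls).
Proof.
elim: ls x => [//|l ls IH] x /= /andP[l2 /IH{}IH] x0 lt.
rewrite spider_starts_cons !inE; case: (ltnP l x) => [lx|xl].
  have := IH (x - l); rewrite subn_gt0 lx => /(_ isT) {}IH.
  have /IH : x - l < sumn ls by lia.
  have mem z : (l + z \in map (addn l) (spider_starts ls)) = (z \in spider_starts ls).
    exact: mem_map (@addnI l) _ _.
  move=> {}IH; have := mem (x - l); have := mem (x - l).+1.
  rewrite addnS subnKC ?(ltnW lx) // => -> ->.
  by case/orP: IH => ->; rewrite !orbT.
have [->|x1] := eqVneq x 1; first by [].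
(* Here [1 < x <= l <= 2]. *)
have -> : x = l by lia.
case: ls lt {IH} => [|l' ls] lt; first by move: lt => /=; lia.
have -> : l.+1 \in map (addn l) (spider_starts (l' :: ls)).
  by rewrite -[l.+1]addn1 (mem_map (@addnI l)) spider_starts_cons inE eqxx.
by rewrite !orbT.
Qed.

Section SpiderDegree.

Variables (n : nat) (ls : seq nat).
Implicit Types x y : 'I_n.

Lemma spider_center x y :
  x = 0 :> nat -> spider ls x y = (val y \in spider_starts ls).
Proof.
move=> x0; rewrite /spider /spider_adj /= x0 /= orbF.
have -> : 0 \in spider_starts ls = false by apply/negP => /spider_starts_gt0.
by rewrite !andbF /= orbF.
Qed.

(** Leaves two candidates: the next vertex of the leg, and the previous one, which is the center if
    [x] is a start. *)
Lemma spider_nbr x y :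
  0 < x -> spider ls x y ->
  (val y == x.+1) && (val y \notin spider_starts ls)
  || (val y == if val x \in spider_starts ls then 0 else x.-1).
Proof.
rewrite /spider /spider_adj /= => x0; rewrite eqn0Ngt x0 /=.
case/orP=> [->//|/orP[/andP[/eqP y0 ->]|/andP[/andP[_ /eqP xy] /negbTE xs]]].
  2: by rewrite xs xy eqxx orbT.
by rewrite y0 eqxx orbT.
Qed.

Lemma deg_le_size (e : rel 'I_n) x s :
  (forall y, e x y -> val y \in s) -> deg e x <= size s.
Proof.
move=> sub; rewrite /deg cardE -(size_map val); apply: uniq_leq_size.
  by rewrite (map_inj_uniq val_inj) enum_uniq.
by move=> _ /mapP[y + ->]; rewrite mem_enum => /sub.
Qed.

Lemma spider_deg_le2 x : 0 < x -> deg (spider ls) x <= 2.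
Proof.
move=> x0; apply: (@deg_le_size _ _ [:: x.+1; if val x \in spider_starts ls then 0 else x.-1]).
move=> y /(spider_nbr x0); rewrite !inE => /orP[/andP[->]|->] //.
by rewrite orbT.
Qed.

Hypothesis sumn_ls : sumn ls = n - 1.

Lemma spider_deg_start x :
  all (leq 2) ls -> val x \in spider_starts ls -> 1 < deg (spider ls) x.
Proof.
move=> ls2 xs; have [nxs lt] := long_leg_second ls2 xs; have x0 := spider_starts_gt0 xs.
have ltn : x.+1 < n by move: lt; rewrite sumn_ls /=; lia.
have lt0 : 0 < n by lia.
apply/card_gt1P; exists (Ordinal ltn), (Ordinal lt0); rewrite !inE; split=> //.
  by rewrite /spider /spider_adj /= x0 eqxx nxs /= orbT.
by rewrite /spider /spider_adj /= xs orbT.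
Qed.

(** A second neighbour would be [x.+1] on the same leg, which [short_leg_end] excludes. *)
Lemma spider_deg_nonstart x :
  all (fun l => l <= 2) ls -> 0 < x -> val x \notin spider_starts ls ->
  deg (spider ls) x <= 1.
Proof.
move=> ls2 x0 xs; apply: (@deg_le_size _ _ [:: x.-1]) => y /(spider_nbr x0).
rewrite (negbTE xs) inE => /orP[/andP[/eqP yx ys]|//].
have lt : val x < sumn ls.
  by have := ltn_ord y; rewrite -[nat_of_ord y]/(val y) yx sumn_ls /=; lia.
by have := short_leg_end ls2 x0 lt; rewrite (negbTE xs) -yx (negbTE ys).
Qed.

End SpiderDegree.

Lemma isomorphic_deg n (e1 e2 : rel 'I_n) (f : 'I_n -> 'I_n) u :
  bijective f -> (forall x y, e1 x y = e2 (f x) (f y)) -> deg e1 u = deg e2 (f u).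
Proof.
move=> [g fK gK] ef; rewrite /deg -(card_image (can_inj fK)); apply: eq_card => y.
rewrite !inE -[y in RHS]gK -ef; apply/imageP/idP => [[x + ->]|?]; first by rewrite fK.
by exists (g y).
Qed.

(* A path has two leaves and at least three other vertices, one of which is not
   adjacent to a leaf. *)
Lemma path_center n (e : rel 'I_n) r p d :
  rooting e r p d -> (forall u, deg e u <= 2) -> deg e r = 2 -> 4 < n ->
  exists w, deg e w = 2 /\ forall y, e w y -> deg e y = 2.
Proof.
move=> rt le2 degr n5.
have deg12 u : (deg e u == 1) || (deg e u == 2).
  have [->|ur] := eqVneq u r; first by rewrite degr.
  by have := deg_gt0 rt ur; have := le2 u; case: (deg e u) => [|[|[]]].
(* Count the vertices other than [r] by parent: [r] has two children, any other vertex of degree 2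
   has one, a leaf none. *)
have cnt : n - 1 = 2 + #|[pred w | (w != r) && (deg e w == 2)]|.
  transitivity (\sum_w #|[pred u | (u != r) && (p u == w)]|).
    have -> : n - 1 = #|predC1 r| by rewrite cardC1 card_ord subn1.
    by rewrite -sum1_card (partition_big p xpredT) //; apply: eq_bigr => w _; rewrite sum1_card.
  rewrite (bigD1 r) //= (card_children rt) eqxx subn0 degr; congr addn.
  rewrite -sum1_card [RHS]big_mkcondr; apply: eq_bigr => w wr.
  by rewrite (card_children rt) wr; case/orP: (deg12 w) => /eqP->.
pose L := [pred w | (w != r) && (deg e w == 1)].
have cardL : #|L| = 2.
  have := cardC1 r; rewrite card_ord -(cardID [pred w | deg e w == 2]).
  have -> : #|[predI predC1 r & [pred w | deg e w == 2]]| = n - 3.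
    by rewrite -(addnK 2 (n - 3)) (_ : n - 3 + 2 = n - 1); [rewrite cnt addKn|lia].
  have -> : #|[predD predC1 r & [pred w | deg e w == 2]]| = #|L|.
    apply: eq_card => w; rewrite !inE andbC; congr andb.
    by case/orP: (deg12 w) => /eqP ->.
  by lia.
(* There are [n - 2 >= 3] vertices of degree 2, and at most two of them are parents of leaves. *)
have [w] : exists w, w \in [predD [pred w | deg e w == 2] & p @: L].
  apply/card_gt0P; have := cardID (mem (p @: L)) [pred w | deg e w == 2].
  have le : #|[predI [pred w | deg e w == 2] & mem (p @: L)]| <= 2.
    rewrite -cardL (leq_trans _ (leq_imset_card p L)) // subset_leq_card //.
    by apply/subsetP => w; rewrite !inE => /andP[].
  rewrite (cardD1 r) !inE degr eqxx.
  rewrite (_ : #|[predD1 _ & r]| = n - 3); last first.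
    by rewrite (_ : n - 3 = n - 1 - 2) ?cnt ?addKn; [apply: eq_card => w; rewrite !inE|lia].
  by move: le; set a := #|_|; set b := #|_|; lia.
rewrite !inE => /andP[wL /eqP degw]; exists w; split=> // y ewy.
case/orP: (deg12 y) => /eqP // degy; case/negP: wL.
have yr : y != r by apply/eqP => yr; rewrite yr degr in degy.
apply/imsetP; exists y; first by rewrite !inE yr degy.
(* A leaf [y] has no neighbour but its parent, so [w] would be [p y]. *)
have /card_le1_eqP : #|[pred u | e y u]| <= 1 by rewrite -degy.
by apply; rewrite inE ?(edge_parent rt yr) // (edge_sym rt).
Qed.

(** * Extremal trees recognised by local degree conditions *)

Section MaxDegree.

Variables (n Delta : nat) (e : rel 'I_n).
Hypotheses (n3 : 2 < n) (D2 : 1 < Delta) (Dn : Delta <= n - 1).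
Hypotheses (tree : is_tree e) (maxE : max_deg e = Delta).

Lemma max_rooting : exists r p d, rooting e r p d /\ deg e r = Delta.
Proof.
have n0 : 0 < #|'I_n| by rewrite card_ord; lia.
have [r maxr] := eq_bigmax (deg e) n0.
by have [p [d rt]] := tree_rooting r tree; exists r, p, d; rewrite -maxE.
Qed.

Lemma deg_le_max u : deg e u <= Delta.
Proof. by rewrite -maxE; apply: leq_bigmax. Qed.

Lemma deg_parent r p d u :
  rooting e r p d -> deg e r = Delta -> u != r -> 1 < deg e (p u) <= Delta.
Proof.
move=> rt degr ur; rewrite deg_le_max andbT.
by have [->|pur] := eqVneq (p u) r; [rewrite degr | exact: (deg_parent_gt1 rt ur pur)].
Qed.

Lemma deg1_or2 r p d u :
  rooting e r p d -> (forall v, v != r -> deg e v <= 2) -> u != r ->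
  deg e u = 1 \/ deg e u = 2.
Proof.
move=> rt narrow ur; have := deg_gt0 rt ur; have := narrow u ur.
by case: (deg e u) => [|[|[]]] //; [left | right].
Qed.

(** The equality case of [wide_slack] at every edge. *)
Definition short_legs r p := forall u, u != r ->
  deg e u = 1 \/ (deg e u = 2 /\ deg e (p u) = Delta).

Lemma short_legs_iso r p d :
  n <= 2 * Delta -> rooting e r p d -> deg e r = Delta ->
  short_legs r p -> isomorphic e (@T_tree n Delta).
Proof.
move=> nD rt degr short.
have narrow u : u != r -> deg e u <= 2 by move=> /short[->|[->]].
pose E := enum [pred u | (u != r) && (p u == r)].
have sizeE : size E = Delta by rewrite -cardE (card_children rt) degr eqxx subn0.
have EP c : c \in E -> c != r /\ p c = r by rewrite mem_enum inE => /andP[? /eqP].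
have leg_pos c : c \in E -> 0 < leg r p d c by move=> /EP[? ?]; apply: (leg_gt0 rt).
have sumE : sumn (map (leg r p d) E) = n - 1.
  by apply: (sumn_legs rt (enum_uniq _ : uniq E)) => c; rewrite mem_enum.
have leg2 c : c \in E -> leg r p d c <= 2.
  have [D3|D2'] : 2 < Delta \/ Delta = 2 by lia.
    (* A vertex of depth at least 3 would have a parent of degree 2, whose own parent, not [r],
       would have degree [Delta > 2]. *)
    move=> _; apply: (leg_le2 rt narrow) => u ur; rewrite leqNgt; apply/negP => du.
    have pur : p u != r.
      by apply/eqP => pur; move: du; rewrite (depthE rt ur) pur (depth_root rt).
    have ppur : p (p u) != r.
      apply/eqP => ppur; move: du.
      by rewrite (depthE rt ur) (depthE rt pur) ppur (depth_root rt).
    have := deg_parent_gt1 rt ur pur; case: (short _ pur) => [->//|[_ degpp] _].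
    by have := narrow _ ppur; rewrite degpp; lia.
  (* Now [n <= 4]: two nonempty legs share at most three vertices. *)
  move: sizeE sumE leg_pos; rewrite D2'; case: E {EP} => [|a [|b []]] //= _ sumE pos.
  have := pos a; have := pos b; rewrite !inE !eqxx orbT => /(_ isT) ? /(_ isT) ?.
  by case/orP=> /eqP ->; lia.
(* [T_tree] lists the one-vertex legs first. *)
pose a := [pred c | leg r p d c == 1]; pose cs := filter a E ++ filter (predC a) E.
have perm_cs : perm_eq cs E by rewrite perm_filterC.
have legs1 : map (leg r p d) (filter a E) = nseq (size (filter a E)) 1.
  rewrite -[X in nseq X](size_map (leg r p d)); apply/all_pred1P/allP => _ /mapP[c + ->].
  by rewrite mem_filter => /andP[].
have legs2 : map (leg r p d) (filter (predC a) E) = nseq (size (filter (predC a) E)) 2.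
  rewrite -[X in nseq X](size_map (leg r p d)); apply/all_pred1P/allP => _ /mapP[c + ->].
  rewrite mem_filter /= => /andP[ac cE]; have := leg_pos c cE; have := leg2 c cE.
  by move: ac; case: (leg r p d c) => [|[|[]]].
have lsE : map (leg r p d) cs = nseq (2 * Delta + 1 - n) 1 ++ nseq (n - Delta - 1) 2.
  have := perm_size perm_cs; rewrite size_cat sizeE => sz.
  have := perm_sumn (perm_map (leg r p d) perm_cs).
  rewrite sumE map_cat sumn_cat legs1 legs2 !sumn_nseq => sm.
  (* There are [Delta] legs with [n - 1] vertices in all; these two equations fix how many legs have
     each length. *)
  by congr (nseq _ _ ++ nseq _ _); lia.
rewrite /T_tree -lsE; apply: (rooting_spider rt narrow).
  by rewrite (perm_uniq perm_cs) enum_uniq.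
by move=> c; rewrite (perm_mem perm_cs) mem_enum.
Qed.

(* For [Delta >= 3] the center of the spider is the only vertex of degree above 2,
   so an isomorphism sends any root of degree [Delta] to it. *)
Lemma spider_iso_root r ls (f : 'I_n -> 'I_n) :
  2 < Delta -> deg e r = Delta -> bijective f ->
  (forall x y, e x y = spider ls (f x) (f y)) ->
  f r = 0 :> nat /\ (forall u, u != r -> 0 < f u).
Proof.
move=> D3 degr bij ef; have fr : f r = 0 :> nat.
  apply/eqP; rewrite eqn0Ngt; apply/negP => fr.
  by have := spider_deg_le2 ls fr; rewrite -(isomorphic_deg r bij ef) degr; lia.
split=> // u ur; rewrite lt0n; apply: contraNneq ur => fu.
by apply/eqP/(bij_inj bij)/val_inj; rewrite /= fr fu.
Qed.

(** For [Delta > 2] a vertex of degree 2 must be a start, hence adjacent to [r]. For [Delta = 2]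
    every parent has degree 2, and the condition is automatic. *)
Lemma T_tree_short_legs r p d :
  n <= 2 * Delta -> rooting e r p d -> deg e r = Delta ->
  isomorphic e (@T_tree n Delta) -> short_legs r p.
Proof.
move=> nD rt degr [f [bij]]; rewrite /T_tree => ef u ur.
have [D3|D2'] : 2 < Delta \/ Delta = 2 by lia.
  have [fr f0] := spider_iso_root D3 degr bij ef.
  have degE v := isomorphic_deg v bij ef.
  have narrow v : v != r -> deg e v <= 2.
    by move=> vr; rewrite degE; apply/spider_deg_le2/f0.
  have [|degu] := deg1_or2 rt narrow ur; first by left.
  right; split=> //; have [->//|pur] := eqVneq (p u) r.
  have := ef r u; rewrite (edgeE rt) eqxx ur (negbTE pur) /= (spider_center _ _ fr).
  have sumn_ls : sumn (nseq (2 * Delta + 1 - n) 1 ++ nseq (n - Delta - 1) 2) = n - 1.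
    by rewrite sumn_cat !sumn_nseq; lia.
  move/esym/negbT => /(spider_deg_nonstart sumn_ls _ (f0 u ur)).
  by rewrite -degE degu all_cat !all_nseq /= !orbT => /(_ isT).
have narrow v : v != r -> deg e v <= 2 by rewrite -D2' deg_le_max.
have := deg_parent rt degr ur; rewrite D2' -eqn_leq => /eqP <-.
by case: (deg1_or2 rt narrow ur); [left | right].
Qed.

(** The equality case of [long_slack] at every edge. *)
Definition long_legs r p := forall u, u != r ->
  deg e u = 2 \/ (deg e u = 1 /\ deg e (p u) = 2).

Lemma rooting_long_spider r p d :
  rooting e r p d -> deg e r = Delta -> (forall u, u != r -> deg e u <= 2) ->
  (forall u, e r u -> deg e u = 2) -> long_spider Delta e.
Proof.
move=> rt degr narrow nbr.
pose E := enum [pred u | (u != r) && (p u == r)].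
have E_uniq : uniq E := enum_uniq _.
have EE : E =i [pred u | (u != r) && (p u == r)] by move=> c; rewrite mem_enum.
exists (map (leg r p d) E); split.
- by rewrite size_map -cardE (card_children rt) degr eqxx subn0.
- apply/allP => _ /mapP[c + ->]; rewrite mem_enum inE => /andP[cr /eqP pc].
  by apply: (leg_gt1 rt) => //; apply: nbr; rewrite (edgeE rt) cr pc eqxx orbT.
- exact: (sumn_legs rt E_uniq EE).
exact: (rooting_spider rt narrow E_uniq EE).
Qed.

Lemma long_legs_spider r p d :
  2 * Delta <= n - 1 -> rooting e r p d -> deg e r = Delta ->
  long_legs r p -> long_spider Delta e.
Proof.
move=> nD rt degr long.
have [D3|D2'] : 2 < Delta \/ Delta = 2 by lia.
  apply: (rooting_long_spider rt degr) => [u /long[->|[->]]//|u].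
  rewrite (edgeE rt) eqxx /= => /andP[ur /eqP pu].
  (* A leaf needs a parent of degree 2, and [r] has degree at least 3. *)
  by case: (long u ur) => [//|[_]]; rewrite pu degr; lia.
(* For [Delta = 2] the given root may be adjacent to a leaf: choose another one. *)
have le2 u : deg e u <= 2 by rewrite -D2' deg_le_max.
have n5 : 4 < n by lia.
have [w [degw nbr]] := path_center rt le2 (etrans degr D2') n5.
have [q [d' rt']] := tree_rooting w tree.
by apply: (rooting_long_spider rt') => //; rewrite degw.
Qed.

Lemma long_spider_long_legs r p d :
  rooting e r p d -> deg e r = Delta -> long_spider Delta e -> long_legs r p.
Proof.
move=> rt degr [ls [_ ls2 sumn_ls [f [bij ef]]]] u ur.
have [D3|D2'] : 2 < Delta \/ Delta = 2 by lia.
  have [fr f0] := spider_iso_root D3 degr bij ef.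
  have degE v := isomorphic_deg v bij ef.
  have narrow v : v != r -> deg e v <= 2.
    by move=> vr; rewrite degE; apply/spider_deg_le2/f0.
  have [degu|] := deg1_or2 rt narrow ur; [right; split=> // | by left].
  have [pur|pur] := eqVneq (p u) r.
    have := ef r u; rewrite (edgeE rt) eqxx ur pur eqxx /= (spider_center _ _ fr).
    by move=> /esym/(spider_deg_start sumn_ls ls2); rewrite -degE degu.
  by apply/eqP; rewrite eqn_leq narrow // (deg_parent_gt1 rt).
have narrow v : v != r -> deg e v <= 2 by rewrite -D2' deg_le_max.
have := deg_parent rt degr ur; rewrite D2' -eqn_leq => /eqP <-.
by case: (deg1_or2 rt narrow ur); [right | left].
Qed.

End MaxDegree.

(** * Powers with a negative exponent *)

Local Open Scope R_scope.

(** Convexity in the exponent: the tangent of [exp] at [t * x] bounds both [1] and [exp x] from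
    below, and these bounds are averaged with weights [1 - t] and [t]. *)
Lemma Rpower_chord (c t b : R) :
  0 <= t <= 1 -> Rpower c (t * b) <= 1 + t * (Rpower c b - 1).
Proof.
move=> [t0 t1]; rewrite /Rpower.
set x := b * ln c; have -> : t * b * ln c = t * x by rewrite /x; ring.
have E1 : exp x = exp (t * x) * exp ((1 - t) * x) by rewrite -exp_plus; f_equal; ring.
have E2 : 1 = exp (t * x) * exp (- (t * x)) by rewrite -exp_plus Rplus_opp_r exp_0.
have := exp_pos (t * x).
have := exp_ineq1_le ((1 - t) * x); have := exp_ineq1_le (- (t * x)).
move: (exp (- (t * x))) (exp ((1 - t) * x)) E1 E2 => u v -> E2 hu hv hE.
move: hE E2; set E := exp (t * x) => hE E2.
have A : t * (E * v) >= t * (E * (1 + (1 - t) * x)).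
  apply/Rle_ge/Rmult_le_compat_l => //; apply: Rmult_le_compat_l; lra.
have B : (1 - t) * (E * u) >= (1 - t) * (E * (1 - t * x)).
  apply/Rle_ge/Rmult_le_compat_l; first lra.
  apply: Rmult_le_compat_l; lra.
nra.
Qed.

Lemma Rpower_inv_sqr (c : R) : 0 < c -> Rpower c (- 2) = / (c * c).
Proof.
move=> c0; rewrite (_ : - 2 = - (1 + 1)); last by lra.
by rewrite Rpower_Ropp Rpower_plus !Rpower_1.
Qed.

Lemma Rpower_div4 (x b : R) : 0 < x -> Rpower x b = Rpower (x / 4) b * Rpower 4 b.
Proof. by move=> x0; rewrite Rpower_mult_distr; [f_equal; field | lra | lra]. Qed.

Lemma Rpower_neg_lt (x y b : R) : b < 0 -> 0 < x < y -> Rpower y b < Rpower x b.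
Proof.
move=> b0 [x0 xy]; rewrite -(Ropp_involutive b) !(Rpower_Ropp _ (- b)).
apply: Rinv_lt_contravar; first by apply: Rmult_lt_0_compat; apply: exp_pos.
by apply: Rlt_Rpower_l; lra.
Qed.

(** The right side is at least twice the geometric mean, that is, twice the power [b / 2] of
    [x * (x + 2)], which is smaller than the square of [x + 1]. *)
Lemma Rpower_midpoint (x b : R) :
  b < 0 -> 0 < x -> 2 * Rpower (x + 1) b < Rpower x b + Rpower (x + 2) b.
Proof.
move=> b0 x0.
have sq y : 0 < y -> Rpower y b = Rpower y (b / 2) * Rpower y (b / 2).
  by move=> y0; rewrite -Rpower_plus; f_equal; field.
have b20 : b / 2 < 0 by lra.
have lt : Rpower ((x + 1) * (x + 1)) (b / 2) < Rpower (x * (x + 2)) (b / 2).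
  by apply: Rpower_neg_lt => //; nra.
move: lt; rewrite -!Rpower_mult_distr; try lra.
rewrite (sq x) ?(sq (x + 1)) ?(sq (x + 2)); try lra.
by have := Rle_0_sqr (Rpower x (b / 2) - Rpower (x + 2) (b / 2)); rewrite /Rsqr; lra.
Qed.

(** * The root exponent and the inequality at branching vertices *)

Section RootExponent.

Variables alpha1 alpha : R.
Hypothesis alpha1_neg : alpha1 < 0.
Hypothesis alpha1_root :
  (Rpower 3 alpha1 - Rpower 4 alpha1) / (Rpower 4 alpha1 - Rpower 5 alpha1) = 2.
Hypothesis alphaP : alpha1 <= alpha < 0.

(** The equation of [alpha1] divided by [Rpower 4 b]. It is convex and vanishes at 0 and at
    [alpha1], hence is nonpositive in between. *)
Let phi (b : R) := Rpower (3 / 4) b + 2 * Rpower (5 / 4) b - 3.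

Let phi_root : phi alpha1 = 0.
Proof.
have p4 : 0 < Rpower 4 alpha1 by apply: exp_pos.
have lt : Rpower 5 alpha1 < Rpower 4 alpha1 by apply: Rpower_neg_lt; lra.
have E : Rpower 3 alpha1 - Rpower 4 alpha1 = 2 * (Rpower 4 alpha1 - Rpower 5 alpha1).
  by rewrite -alpha1_root; field; lra.
move: E; rewrite (@Rpower_div4 3) ?(@Rpower_div4 5); try lra.
move=> E; apply: (Rmult_eq_reg_r (Rpower 4 alpha1)); last lra.
by rewrite /phi; lra.
Qed.

Let phi_chord (t : R) : 0 <= t <= 1 -> phi (t * alpha1) <= 0.
Proof.
move=> ht; have := Rpower_chord (3 / 4) alpha1 ht.
have := Rpower_chord (5 / 4) alpha1 ht.
have := phi_root; rewrite /phi => E ? ?.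
have : t * (Rpower (3 / 4) alpha1 + 2 * Rpower (5 / 4) alpha1 - 3) = 0 by rewrite E; ring.
lra.
Qed.

(** Otherwise [-2] would lie between [alpha1] and 0, whereas [phi (-2)] is 13/225. *)
Lemma root_exponent_gt : - 2 < alpha1.
Proof.
case: (Rlt_le_dec (-2) alpha1) => // le.
have t01 : 0 <= - 2 / alpha1 <= 1.
  rewrite (_ : - 2 / alpha1 = 2 * / (- alpha1)); last by field; lra.
  have i0 : 0 < / (- alpha1) by apply: Rinv_0_lt_compat; lra.
  have : / (- alpha1) * (- alpha1) = 1 by field; lra.
  nra.
have := phi_chord t01; rewrite (_ : - 2 / alpha1 * alpha1 = - 2); last by field; lra.
by rewrite /phi !Rpower_inv_sqr; lra.
Qed.

(* After division by [Rpower 4 alpha] the inequality compares with [0] a convex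
   function of [alpha] vanishing at [0]; it is enough to test it at [alpha1] for
   [a = 3] and at [-2 < alpha1] for [a >= 4]. *)
Lemma branching_loss (a : R) :
  a = 3 \/ 4 <= a ->
  (a - 2) * (Rpower 3 alpha - Rpower 4 alpha)
    <= (a - 1) * (Rpower 4 alpha - Rpower (a + 2) alpha).
Proof.
move=> ha; have p4 : 0 < Rpower 4 alpha by apply: exp_pos.
suff: (a - 2) * Rpower (3 / 4) alpha + (a - 1) * Rpower ((a + 2) / 4) alpha
        - (2 * a - 3) <= 0.
  rewrite (@Rpower_div4 3) ?(@Rpower_div4 (a + 2)); try lra.
  by nra.
case: ha => [->|a4].
  have t01 : 0 <= alpha / alpha1 <= 1.
    rewrite (_ : alpha / alpha1 = (- alpha) * / (- alpha1)); last by field; lra.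
    have i0 : 0 < / (- alpha1) by apply: Rinv_0_lt_compat; lra.
    have : / (- alpha1) * (- alpha1) = 1 by field; lra.
    nra.
  have := phi_chord t01; rewrite (_ : alpha / alpha1 * alpha1 = alpha); last by field; lra.
  rewrite /phi (_ : 3 + 2 = 5); last ring. lra.
have gt2 := root_exponent_gt.
(* Position of [alpha] on the chord from exponent 0 to exponent -2. *)
have t01 : 0 <= - alpha / 2 <= 1 by lra.
have := Rpower_chord (3 / 4) (- 2) t01.
have := Rpower_chord ((a + 2) / 4) (- 2) t01.
rewrite (_ : - alpha / 2 * - 2 = alpha); last by field.
rewrite !Rpower_inv_sqr; try lra.
set t := - alpha / 2 in t01 *.
have -> : / (3 / 4 * (3 / 4)) = 16 / 9 by field.
set y := / _; set u := Rpower _ alpha; set v := Rpower _ alpha => hu hv.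
(* The value at exponent -2. For [a = 3] it would be positive, which is why that case is tested at
   [alpha1]. *)
have slope : (a - 2) * (16 / 9) + (a - 1) * y - (2 * a - 3) <= 0.
  have yE : y * ((a + 2) * (a + 2)) = 16 by rewrite /y; field; lra.
  apply: (Rmult_le_reg_r ((a + 2) * (a + 2))); first by nra.
  rewrite Rmult_0_l Rmult_minus_distr_r Rmult_plus_distr_r (Rmult_assoc (a - 1)) yE.
  nra.
have Hv : (a - 2) * v <= (a - 2) * (1 + t * (16 / 9 - 1)) by apply: Rmult_le_compat_l; lra.
have Hu : (a - 1) * u <= (a - 1) * (1 + t * (y - 1)) by apply: Rmult_le_compat_l; lra.
(* Since [(a - 2) + (a - 1) = 2 * a - 3], the constants of the chord bounds cancel and [t] times the
   value at -2 remains. *)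
have : t * ((a - 2) * (16 / 9) + (a - 1) * y - (2 * a - 3)) <= 0 by nra.
nra.
Qed.
End RootExponent.

(** * Summation over the edges *)

HB.instance Definition _ := Monoid.isComLaw.Build R 0 Rplus
  (fun x y z => esym (Rplus_assoc x y z)) Rplus_comm Rplus_0_l.

Local Notation "\rsum_ ( i | P ) F" := (\big[Rplus/0]_(i | P%B) F)
  (at level 36, F at level 36, i at level 50, format "\rsum_ ( i  |  P )  F").

Lemma rsum_const (I : finType) (A : {pred I}) (c : R) :
  \rsum_(i | i \in A) c = INR #|A| * c.
Proof.
rewrite big_const; elim: #|A| => [|k IH]; first by rewrite Rmult_0_l.
by rewrite iterS IH S_INR; ring.
Qed.

Lemma rsum_linear (I : finType) (P : pred I) (a b : R) (F G : I -> R) :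
  \rsum_(i | P i) (a * F i + b * G i)
    = a * \rsum_(i | P i) F i + b * \rsum_(i | P i) G i.
Proof.
by apply: (big_ind3 (fun x y z => x = a * y + b * z)) => //; [ring|move=> *; subst; ring].
Qed.

Lemma rsum_nonpos (I : finType) (P : pred I) (F : I -> R) :
  (forall i, P i -> F i <= 0) -> \rsum_(i | P i) F i <= 0.
Proof. by move=> F0; elim/big_ind: _ => // [|x y]; lra. Qed.

Lemma rsum_nonpos_eq0 (I : finType) (P : pred I) (F : I -> R) :
  (forall i, P i -> F i <= 0) ->
  \rsum_(i | P i) F i = 0 <-> forall i, P i -> F i = 0.
Proof.
move=> F0; split=> [s0 i Pi|]; last by move=> F00; rewrite big1.
move: s0; rewrite (bigD1 i) //= => s0.
have := @rsum_nonpos _ (fun j => P j && (j != i)) F; have := F0 _ Pi.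
by move=> ? /(_ (fun j Hj => F0 j (proj1 (andP Hj)))); lra.
Qed.

Section EdgeSum.

Variables (n : nat) (e : rel 'I_n) (r : 'I_n) (p : 'I_n -> 'I_n) (d : 'I_n -> nat).
Hypothesis rt : rooting e r p d.

(** [chi] lists each edge once, smaller end first: [h] orders the edge from [u] to its parent and
    [h'] recovers the child. *)
Lemma chi_parent (alpha : R) :
  chi e alpha = \rsum_(u | u != r) Rpower (INR (deg e u + deg e (p u))) alpha.
Proof.
rewrite /chi foldrE big_map big_filter big_enum_cond /=.
pose h (u : 'I_n) := if (u < p u)%N then (u, p u) else (p u, u).
pose h' (xy : 'I_n * 'I_n) := if (xy.1 != r) && (p xy.1 == xy.2) then xy.1 else xy.2.
rewrite (reindex_onto h h') /=.
  apply: eq_big => [u|u _]; last by rewrite /h; case: ifP => //= _; rewrite addnC.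
  have [->|ur] := eqVneq u r; first by rewrite /h (parent_root rt) ltnn /= ltnn.
  have ppu : ~~ ((p u != r) && (p (p u) == u)).
    apply/negP => /andP[pur /eqP ppu].
    by have := depthE rt ur; have := depthE rt pur; rewrite ppu; lia.
  have eup := edge_parent rt ur; rewrite /h; case: (ltnP u (p u)) => [lt|ge] /=.
    by rewrite lt eup /h' /= ur eqxx /= eqxx.
  rewrite /h' /= (negbTE ppu) eqxx andbT (edge_sym rt) eup andbT ltn_neqAle ge andbT.
  exact: (parent_neq rt ur).
move=> [x y] /= /andP[lt exy]; rewrite /h' /=.
case: ifP => [/andP[_ /eqP py]|npar]; first by rewrite /h py lt.
move: exy; rewrite (edgeE rt) npar /= => /andP[_ /eqP py].
by rewrite /h py ltnNge (ltnW lt).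
Qed.

Lemma sum_parent (F : 'I_n -> R) :
  \rsum_(u | u != r) F (p u)
    = INR (deg e r) * F r + \rsum_(u | u != r) ((INR (deg e u) - 1) * F u).
Proof.
rewrite (partition_big p xpredT) //=.
rewrite (eq_bigr (fun w => INR (deg e w - (w != r)) * F w)); last first.
  move=> w _; rewrite -(card_children rt) -rsum_const.
  by apply: eq_big => [u|u /andP[_ /eqP ->]].
rewrite (bigD1 r) //= eqxx subn0; f_equal; apply: eq_bigr => u ur.
by rewrite ur minus_INR //; apply/leP/(deg_gt0 rt ur).
Qed.

(* Defect of the edge from a vertex of degree [a] up to its parent of degree [b]:
   the terms [psi] telescope along the rooted tree, and every edge is charged [lam]. *)
Definition slack (alpha lam : R) (psi : nat -> R) (a b : nat) : R :=
  Rpower (INR (a + b)) alpha - lam + (INR a - 1) * psi a - psi b.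

(** By [sum_parent] the [psi] terms of the slacks cancel except for the share of the root. *)
Lemma chi_slack (alpha lam : R) (psi : nat -> R) :
  chi e alpha = INR (n - 1) * lam + INR (deg e r) * psi (deg e r)
                + \rsum_(u | u != r) slack alpha lam psi (deg e u) (deg e (p u)).
Proof.
have cst : \rsum_(u | u != r) lam = INR (n - 1) * lam.
  rewrite (rsum_const (predC1 r)) cardC1 card_ord; congr (INR _ * _); lia.
have := sum_parent (fun u => psi (deg e u)); rewrite chi_parent -cst => /=.
set s1 := \big[_/_]_(_ | _) psi _; set s2 := \big[_/_]_(_ | _) (_ * _) => E.
have -> : \rsum_(u | u != r) slack alpha lam psi (deg e u) (deg e (p u))
  = 1 * \rsum_(u | u != r) Rpower (INR (deg e u + deg e (p u))) alpha
    + - 1 * \rsum_(u | u != r) lam + (1 * s2 + - 1 * s1).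
  rewrite -!rsum_linear -big_split; apply: eq_bigr => u _ /=; rewrite /slack; ring.
rewrite E; set t1 := bigop _ _ _; set t2 := bigop _ _ _.
by rewrite -/t1 -/t2; ring.
Qed.

Lemma chi_le_slack (alpha lam : R) (psi : nat -> R) :
  (forall u, u != r -> slack alpha lam psi (deg e u) (deg e (p u)) <= 0) ->
  let bound := INR (n - 1) * lam + INR (deg e r) * psi (deg e r) in
  chi e alpha <= bound /\
  (chi e alpha = bound <->
     forall u, u != r -> slack alpha lam psi (deg e u) (deg e (p u)) = 0).
Proof.
move=> s0 /=; rewrite (chi_slack alpha lam psi).
have := rsum_nonpos s0; have := rsum_nonpos_eq0 s0.
set s := \big[_/_]_(_ | _) _ => iff0 le0; split; first lra.
by rewrite -iff0; split; lra.
Qed.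

End EdgeSum.

(** * Signs of the slacks for the two choices of weights *)

Lemma Rpower_INR_lt (alpha : R) (x y : nat) :
  alpha < 0 -> (0 < x < y)%N -> Rpower (INR y) alpha < Rpower (INR x) alpha.
Proof.
move=> neg /andP[x0 xy]; apply: Rpower_neg_lt => //.
by split; [apply: lt_0_INR | apply: lt_INR]; lia.
Qed.

(** Strict convexity: [Rpower_midpoint] compares neighbouring gaps and is iterated from [x] to
    [y]. *)
Lemma Rpower_INR_gap (alpha : R) (x y : nat) :
  alpha < 0 -> (0 < x < y)%N ->
  Rpower (INR y) alpha - Rpower (INR y.+1) alpha
    < Rpower (INR x) alpha - Rpower (INR x.+1) alpha.
Proof.
move=> neg /andP[x0 xy]; have step k : (0 < k)%N ->
    Rpower (INR k.+1) alpha - Rpower (INR k.+2) alpha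
      < Rpower (INR k) alpha - Rpower (INR k.+1) alpha.
  move=> k0; have k0R : 0 < INR k by apply: lt_0_INR; lia.
  have := Rpower_midpoint neg k0R; rewrite !S_INR.
  rewrite (_ : INR k + 1 + 1 = INR k + 2); [lra | ring].
rewrite -(subnK xy); elim: (y - x.+1)%N => [|k IH]; first exact: step.
have := @step (k + x.+1)%N; rewrite !addSn.
by move: IH; rewrite addnS => IH /(_ isT) ?; lra.
Qed.

(* For [n <= 2 * Delta]: [wide_lam] is the cost per vertex for which a pendant
   vertex and a pendant path of length two at the center have the same value, and
   [wide_psi b] is the value of a pendant vertex at a parent of degree [b]. *)
Definition wide_lam (alpha : R) (Delta : nat) : R :=
  Rpower (INR Delta.+2) alpha - Rpower (INR Delta.+1) alpha + Rpower (INR 3) alpha.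

Definition wide_psi (alpha : R) (Delta b : nat) : R :=
  Rpower (INR b.+1) alpha - wide_lam alpha Delta.

(** For [a = 1] the slack is identically 0. For [a = 2] it is the gap of powers at [Delta + 1] minus
    the gap at [b + 1]. For [a >= 3] both [Rpower (a + b) - Rpower (b + 1)] and the term in
    [wide_psi a] have the right sign, the first strictly. *)
Lemma wide_slack (alpha : R) (Delta a b : nat) :
  alpha < 0 -> (0 < a)%N -> (1 < b <= Delta)%N ->
  let s := slack alpha (wide_lam alpha Delta) (wide_psi alpha Delta) a b in
  s <= 0 /\ (s = 0 <-> a = 1%N \/ (a = 2%N /\ b = Delta)).
Proof.
move=> neg a0 /andP[b1 bD] s; rewrite {}/s /slack /wide_psi.
have lam4 : Rpower (INR 4) alpha <= wide_lam alpha Delta.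
  rewrite /wide_lam; have [->|D2] : Delta = 2%N \/ (2 < Delta)%N by lia.
    lra.
  have /(Rpower_INR_gap neg) ? : (0 < 3 < Delta.+1)%N by lia.
  lra.
case: a a0 => [|[|[|a]]] // _; rewrite !addSn ?add0n.
- by rewrite INR_1; split; [lra | split; [left | lra]].
- rewrite (_ : INR 2 = 2) // /wide_lam.
  have [bD'|bD'] : b = Delta \/ (b < Delta)%N by lia.
    by rewrite bD'; split; [lra | split; [right | lra]].
  have /(Rpower_INR_gap neg) ? : (0 < b.+1 < Delta.+1)%N by lia.
  split; first lra; split; last by case=> [|[_]]; lia.
  lra.
have lt1 := @Rpower_INR_lt alpha 4 (a + 4) neg.
have lt2 : Rpower (INR (a + b).+3) alpha < Rpower (INR b.+1) alpha.
  by apply: Rpower_INR_lt => //; lia.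
have le1 : Rpower (INR a.+4) alpha <= Rpower (INR 4) alpha.
  have [->|a0] : a = 0%N \/ (0 < a)%N by lia.
    lra.
  by apply/Rlt_le/Rpower_INR_lt => //; lia.
have a2 : 0 <= INR a.+3 - 1 by rewrite S_INR; have := pos_INR a.+2; lra.
have : (INR a.+3 - 1) * (Rpower (INR a.+4) alpha - wide_lam alpha Delta) <= 0.
  by nra.
move=> ?; split; first lra; split; last by case=> [|[]].
lra.
Qed.

(* For [2 * Delta <= n - 1], where every edge costs [4 ^ alpha]: the value of a
   pendant path with at least two vertices at a parent of degree [b]. *)
Definition long_psi (alpha : R) (b : nat) : R :=
  Rpower (INR 3) alpha - 2 * Rpower (INR 4) alpha + Rpower (INR b.+2) alpha.

(** For [a = 1] the slack is the gap of powers at [b + 1] minus the gap at 3, and for [a = 2] it is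
    identically 0. For [a >= 3] it is [Rpower (a + b) - Rpower (b + 2)], which is negative, plus the
    difference of the two sides of [branching_loss]. *)
Lemma long_slack (alpha1 alpha : R) (a b : nat) :
  alpha1 < 0 ->
  (Rpower 3 alpha1 - Rpower 4 alpha1) / (Rpower 4 alpha1 - Rpower 5 alpha1) = 2 ->
  alpha1 <= alpha < 0 -> (0 < a)%N -> (1 < b)%N ->
  let s := slack alpha (Rpower (INR 4) alpha) (long_psi alpha) a b in
  s <= 0 /\ (s = 0 <-> a = 2%N \/ (a = 1%N /\ b = 2%N)).
Proof.
move=> neg1 root alphaP a0 b1 s; have neg : alpha < 0 by lra.
rewrite {}/s /slack /long_psi.
case: a a0 => [|[|[|a]]] // _; rewrite !addSn ?add0n.
- rewrite INR_1; have [->|b2] : b = 2%N \/ (2 < b)%N by lia.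
    by split; [lra | split; [right | lra]].
  have /(Rpower_INR_gap neg) ? : (0 < 3 < b.+1)%N by lia.
  split; first lra; split; last by case=> [|[_]]; lia.
  lra.
- rewrite (_ : INR 2 = 2) //; split; [lra | split; [by left | lra]].
have lt : Rpower (INR (a + b).+3) alpha < Rpower (INR b.+2) alpha.
  by apply: Rpower_INR_lt => //; lia.
have := @branching_loss alpha1 alpha neg1 root alphaP (INR a.+3).
have -> : Rpower (INR a.+3 + 2) alpha = Rpower (INR a.+3.+2) alpha.
  by f_equal; rewrite !S_INR; ring.
have -> : 3 = INR 3 by rewrite /=; ring.
have -> : 4 = INR 4 by rewrite /=; ring.
have a3 : INR a.+3 = INR 3 \/ INR 4 <= INR a.+3.
  case: a {lt} => [|a]; first by left.
  by right; apply: le_INR; lia.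
move=> /(_ a3) loss.
by split; [|split; [|by case=> [|[]]]]; nra.
Qed.

Theorem theorem1 (n Delta : nat) (alpha1 alpha : R)
  (Hn : (3 <= n)%N) (HD1 : (2 <= Delta)%N) (HD2 : (Delta <= n - 1)%N)
  (Ha1neg : (alpha1 < 0))
  (Ha1root : ((Rpower 3 alpha1 - Rpower 4 alpha1) / (Rpower 4 alpha1 - Rpower 5 alpha1) = 2))
  (Ha1uniq : forall a : R, (a < 0) ->
      ((Rpower 3 a - Rpower 4 a) / (Rpower 4 a - Rpower 5 a) = 2) -> a = alpha1)
  (Ha : (alpha1 <= alpha < 0))
  (e : rel 'I_n) (Htree : is_tree e) (Hmax : max_deg e = Delta) :
  ((n <= 2 * Delta)%N ->
     (chi e alpha <=
        (Rpower (INR Delta + 2) alpha - Rpower (INR Delta + 1) alpha + Rpower 3 alpha)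
          * INR (n - Delta - 1) + INR Delta * Rpower (INR Delta + 1) alpha)
     /\ (chi e alpha =
        (Rpower (INR Delta + 2) alpha - Rpower (INR Delta + 1) alpha + Rpower 3 alpha)
          * INR (n - Delta - 1) + INR Delta * Rpower (INR Delta + 1) alpha
         <-> isomorphic e (@T_tree n Delta)))
  /\
  ((2 * Delta <= n - 1)%N ->
     (chi e alpha <=
        (Rpower (INR Delta + 2) alpha + Rpower 3 alpha - Rpower 4 alpha) * INR Delta
          + INR (n - Delta - 1) * Rpower 4 alpha)
     /\ (chi e alpha =
        (Rpower (INR Delta + 2) alpha + Rpower 3 alpha - Rpower 4 alpha) * INR Delta
          + INR (n - Delta - 1) * Rpower 4 alpha
         <-> @long_spider n Delta e)).
Proof.
have neg : alpha < 0 by lra.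
have [r [p [d [rt degr]]]] := max_rooting Hn HD1 HD2 Htree Hmax.
have degP u : u != r -> (0 < deg e u)%N /\ (1 < deg e (p u) <= Delta)%N.
  by move=> ur; split; [exact: (deg_gt0 rt ur) | apply: (deg_parent HD1 Hmax rt degr ur)].
have E3 : 3 = INR 3 by rewrite /=; ring.
have E4 : 4 = INR 4 by rewrite /=; ring.
have ED1 : INR Delta + 1 = INR Delta.+1 by rewrite S_INR.
have ED2 : INR Delta + 2 = INR Delta.+2 by rewrite !S_INR; ring.
have En : INR (n - 1) = INR (n - Delta - 1) + INR Delta.
  by rewrite -plus_INR; congr INR; lia.
split=> nD.
  have slackP u (ur : u != r) := wide_slack neg (degP u ur).1 (degP u ur).2.
  have [le iff] := chi_le_slack rt (fun u ur => (slackP u ur).1).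
  rewrite E3 ED1 ED2; set bound := _ + _.
  (* Of the [n - 1] charges [wide_lam], [Delta] cancel against those inside
     [wide_psi alpha Delta Delta]. *)
  have boundE : INR (n - 1) * wide_lam alpha Delta
      + INR (deg e r) * wide_psi alpha Delta (deg e r) = bound.
    by rewrite degr En /bound /wide_psi /wide_lam; ring.
  rewrite boundE in le iff; split=> //; rewrite iff; split=> [s0|iso].
    apply: (short_legs_iso Hn HD1 HD2 Hmax nD rt degr) => u ur.
    exact/(slackP u ur).2/s0.
  have short := T_tree_short_legs Hn HD1 HD2 Hmax nD rt degr iso.
  by move=> u ur; apply/(slackP u ur).2/short.
have slackP u (ur : u != r) := long_slack Ha1neg Ha1root Ha (degP u ur).1
  (proj1 (andP (degP u ur).2)).
have [le iff] := chi_le_slack rt (fun u ur => (slackP u ur).1).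
rewrite E3 E4 ED2; set bound := _ + _.
have boundE : INR (n - 1) * Rpower (INR 4) alpha
    + INR (deg e r) * long_psi alpha (deg e r) = bound.
  by rewrite degr En /bound /long_psi; ring.
rewrite boundE in le iff; split=> //; rewrite iff; split=> [s0|iso].
  apply: (long_legs_spider Hn HD1 HD2 Htree Hmax nD rt degr) => u ur.
  exact/(slackP u ur).2/s0.
have long := long_spider_long_legs Hn HD1 HD2 Hmax rt degr iso.
by move=> u ur; apply/(slackP u ur).2/long.
Qed.
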